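(* For all $m\ge1$, the sequences $A^{(m)}$ and $B^{(m)}$ coincide.
   Context: Strings may be finite or infinite. For a nonempty finite string $U$ of positive integers, $\mathcal{C}(U)$ is the largest integer $k\ge1$ with $U=XY^k$ for strings $X,Y$, $Y$ nonempty; $\mathcal{C}^{(m)}(U)=\max\{m,\mathcal{C}(U)\}$. For $m\ge1$ the sequence $A^{(m)}=a^{(m)}(1),a^{(m)}(2),\ldots$ is given by $a^{(m)}(1)=m$, $a^{(m)}(i+1)=\mathcal{C}^{(m)}(a^{(m)}(1),\ldots,a^{(m)}(i))$. Fix $m$. Blocks and glue: $B_1^{(m)}=m$; for $n\ge1$, if $B_n^{(m)}$ is infinite then $B_{n+1}^{(m)}=B_n^{(m)}$ and $S_i^{(m)}=\emptyset$ for $i\ge n$; if $B_n^{(m)}$ is finite, let $s(1)=\mathcal{C}^{(m)}((B_n^{(m)})^{m+1})$, $s(i+1)=\mathcal{C}^{(m)}((B_n^{(m)})^{m+1}s(1)\ldots s(i))$; if some $i\ge1$ has $s(i+1)<m+1$, with $i$ least, $S_n^{(m)}=s(1),\ldots,s(i)$, otherwise $S_n^{(m)}=s(1),s(2),\ldots$ (infinite); and $B_{n+1}^{(m)}=(B_n^{(m)})^{m+1}S_n^{(m)}$. Since each $B_n^{(m)}$ is a prefix of $B_{n+1}^{(m)}$, the limit $B^{(m)}=\lim_{n\to\infty}B_n^{(m)}$ is well defined. *)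

(* Defs.v *)
From mathcomp Require Import all_boot.
From mathcomp Require Import boolp.

Set Implicit Arguments.
Unset Strict Implicit.
Unset Printing Implicit Defensive.

(* Letters are natural numbers. All strings used below, for m >= 1, have
   positive letters only. Letters of strings are indexed from 0. *)
Inductive str := Fin of seq nat | Inf of (nat -> nat).

Definition letter (U : str) (i : nat) : option nat :=
  match U with
  | Fin s => onth s i
  | Inf f => Some (f i)
  end.

Definition scat (s : seq nat) (U : str) : str :=
  match U with
  | Fin t => Fin (s ++ t)
  | Inf f => Inf (fun i => if i < size s then nth 0 s i else f (i - size s))
  end.

Definition power (Y : seq nat) (k : nat) : seq nat := flatten (nseq k Y).

Definition ends_with_power (U : seq nat) (k : nat) : Prop :=
  exists X Y : seq nat, Y <> [::] /\ U = X ++ power Y k.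

(* Since Y is nonempty, only k <= size U can occur, see curl_spec. *)
Definition curl (U : seq nat) : nat :=
  \max_(k < (size U).+1 | `[< ends_with_power U k >]) k.

Lemma curl_spec (U : seq nat) : U <> [::] ->
  [/\ 1 <= curl U, ends_with_power U (curl U)
    & forall k, ends_with_power U k -> k <= curl U].
Proof.
move=> U0.
have maxU k : ends_with_power U k -> k <= curl U.
  move=> Uk; have ltk : k < (size U).+1.
    case: Uk => X [Y [/eqP Y0 ->]]; rewrite ltnS size_cat.
    apply: leq_trans (leq_addl _ _); rewrite /power size_flatten /shape map_nseq.
    by rewrite sumn_nseq leq_pmull // lt0n size_eq0.
  have/asboolP Uk' := Uk.
  exact: (@leq_bigmax_cond _ (fun k : 'I__ => `[< ends_with_power U k >])
    (fun k => k) (Ordinal ltk)).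
have U1 : ends_with_power U 1.
  by exists [::], U; rewrite /power /= cats0.
split=> //; first exact: maxU.
rewrite /curl; case: (@eq_bigmax_cond _
  (fun k : 'I_(size U).+1 => `[< ends_with_power U k >]) (fun k => k)).
  apply/card_gt0P; have lt1 : 1 < (size U).+1.
    by rewrite ltnS lt0n size_eq0; apply/eqP.
  by exists (Ordinal lt1); apply/asboolP.
by move=> k /asboolP Uk ->.
Qed.

Definition curlm (m : nat) (U : seq nat) : nat := maxn m (curl U).

(* The first n terms s(1), ..., s(n) of the sequence determined by
   s(i+1) = curlm m (P s(1) ... s(i)). *)
Fixpoint continuation (m : nat) (P : seq nat) (n : nat) : seq nat :=
  if n is i.+1 then
    rcons (continuation m P i) (curlm m (P ++ continuation m P i))
  else [::].

(* s(i+1) *)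
Definition next_term (m : nat) (P : seq nat) (i : nat) : nat :=
  curlm m (P ++ continuation m P i).

(* A m i is the term of 1-based index i+1. *)
Definition A (m i : nat) : nat :=
  if i is j.+1 then next_term m [:: m] j else m.

Definition glue_stops (m : nat) (P : seq nat) (i : nat) : bool :=
  (1 <= i) && (next_term m P i < m.+1).

Definition glue_after (m : nat) (P : seq nat) : str :=
  match pselect (exists i, glue_stops m P i) with
  | left stops => Fin (continuation m P (ex_minn stops))
  | right _ => Inf (next_term m P)
  end.

Definition glue_of (m : nat) (b : str) : str :=
  match b with
  | Fin s => glue_after m (power s m.+1)
  | Inf _ => Fin [::]
  end.

Definition next_block (m : nat) (b : str) : str :=
  match b with
  | Fin s => scat (power s m.+1) (glue_of m b)
  | Inf _ => b
  end.

(* block m n is the block of 1-based index n+1, and glue m n its glue. *)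
Definition block (m n : nat) : str := iter n (next_block m) (Fin [:: m]).

Definition glue (m n : nat) : str := glue_of m (block m n).

(* At an infinite block, the glue is empty and the block is repeated. *)
Lemma blockS (m n : nat) : block m n.+1 =
  match block m n with
  | Fin s => scat (power s m.+1) (glue m n)
  | Inf _ => block m n
  end.
Proof. by rewrite /block iterS -/(block m n) /glue; case: (block m n). Qed.

(* Letterwise convergence; a position past the end of a string has letter
   None, so the limit may be finite or infinite. *)
Definition converges (U : nat -> str) (L : str) : Prop :=
  forall i, exists N, forall n, N <= n -> letter (U n) i = letter L i.

Lemma letter_inj (U V : str) : letter U =1 letter V -> U = V.
Proof.
have lt_onth (s : seq nat) i : (onth s i == None) = (size s <= i).
  by elim: s i => [|x s IH] [|i] //=; rewrite ltnS -IH.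
case: U V => [s|f] [t|g] /= UV.
- congr Fin; elim: s t UV {lt_onth} => [|x s IH] [|y t] // UV.
  + by have := UV 0.
  + by have := UV 0.
  + by have [->] := UV 0; rewrite (IH t) // => i; have := UV i.+1.
- by have := lt_onth s (size s); have /= -> := UV (size s); rewrite leqnn.
- by have := lt_onth t (size t); have /= <- := UV (size t); rewrite leqnn.
- by congr Inf; apply/funext => i; have [] := UV i.
Qed.

Lemma converges_unique (U : nat -> str) (L M : str) :
  converges U L -> converges U M -> L = M.
Proof.
move=> UL UM; apply: letter_inj => i.
have [N1 H1] := UL i; have [N2 H2] := UM i.
by rewrite -(H1 (maxn N1 N2)) ?leq_maxl // H2 ?leq_maxr.
Qed.

(* The default value, for sequences without limit, is irrelevant to B by
   block_converges. *)
Definition limit (U : nat -> str) : str :=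
  match pselect (exists L, converges U L) with
  | left cvU => sval (cid cvU)
  | right _ => Fin [::]
  end.

Definition B (m : nat) : str := limit (block m).

Definition prefix_of (U V : str) : Prop :=
  forall i x, letter U i = Some x -> letter V i = Some x.

Lemma onth_some (s : seq nat) i x :
  onth s i = Some x -> i < size s /\ nth 0 s i = x.
Proof. by elim: s i => [|y s IH] [|i] //=; [case=> -> | exact: IH]. Qed.

Lemma onth_lt (s : seq nat) i : i < size s -> onth s i = Some (nth 0 s i).
Proof. by elim: s i => [|y s IH] [|i] //= /IH. Qed.

Lemma prefix_scat (s : seq nat) (U : str) : prefix_of (Fin s) (scat s U).
Proof.
move=> i x /= /onth_some[lti <-]; case: U => [t|f] /=; last by rewrite lti.
by rewrite onth_lt ?size_cat ?ltn_addr // nth_cat lti.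
Qed.

Lemma prefix_block (m n : nat) : prefix_of (block m n) (block m n.+1).
Proof.
rewrite blockS; case: (block m n) => [s|f] // i x sx.
apply: prefix_scat; move: sx => /= /onth_some[lti <-].
rewrite /power /= onth_lt ?size_cat ?ltn_addr //.
by rewrite nth_cat lti.
Qed.

Lemma letter_block (m n i : nat) : 1 <= m -> i <= n -> letter (block m n) i <> None.
Proof.
move=> m1; elim: n i => [|n IH] i.
  by rewrite leqn0 => /eqP->.
rewrite leq_eqVlt => /orP[/eqP->|]; last first.
  rewrite ltnS => /IH; have := @prefix_block m n i.
  by case: (letter (block m n) i) => // x /(_ _ erefl)->.
move: (IH n (leqnn n)); rewrite blockS; case: (block m n) => [s|f] //= sn.
have ltn_s : n < size s.
  by case E: (onth s n) sn => [x|] // _; have [] := onth_some E.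
have lt2 : n.+1 < size (power s m.+1).
  rewrite /power size_flatten /shape map_nseq sumn_nseq.
  apply: leq_trans (leq_mul ltn_s (_ : 2 <= m.+1)) => //.
  by rewrite muln2 -addnn addSn addnS !ltnS leq_addr.
by rewrite (@prefix_scat (power s m.+1) (glue m n) n.+1 _ (onth_lt lt2)).
Qed.

(* The limit defining B m exists. *)
Lemma block_converges (m : nat) : 1 <= m -> converges (block m) (B m).
Proof.
move=> m1; rewrite /B /limit; case: pselect => [cv|[]]; first exact: svalP.
exists (Inf (fun i => odflt 0 (letter (block m i) i))) => i; exists i => n.
elim: n => [|n IH].
  by rewrite leqn0 => /eqP->.
rewrite leq_eqVlt => /orP[/eqP->|].
  by have := @letter_block m n.+1 n.+1 m1 (leqnn _) => /=; case: letter.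
by rewrite ltnS => /IH /= /prefix_block.
Qed.

(* Main.v *)
Require Import Defs.
From mathcomp Require Import all_boot.
From mathcomp Require Import boolp.

Set Implicit Arguments.
Unset Strict Implicit.
Unset Printing Implicit Defensive.

(* The point is that the curling rule, read along B^(m+1) for a finite block B,
   never looks past the last copy of B: for j <= m and V a proper prefix of B,
   curlm m (B^j V) = curlm m V when V is nonempty, and curlm m (B^j) = m when
   j > 0. Every block is then generated by its own curling numbers.

   Boundaries between copies of B are recognised by the length of the run of
   letters other than m that precedes them: the runs of a block are
   S_1 ... S_i, and the longest one occurs only at the end of the block. If Y^k
   with k > m is a suffix of B^j V longer than V, comparing the runs at the
   ends of the copies of Y with these boundaries leaves two cases.
   - V = T (Z T)^m with Y = Z T and no letter m in Z. The letter following the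
     prefix T of B is then larger than m, so T already has curling number
     larger than m.
   - m = 1 and B ends in Y' V Y' for some nonempty Y' without the letter 1.
     This would force B to end in a square, while its curling number is 1. *)

(** * Concatenation, powers and curling numbers *)

Lemma cat_eq_cat (T : Type) (s1 t1 s2 t2 : seq T) :
  s1 ++ t1 = s2 ++ t2 -> size s1 <= size s2 ->
  exists2 u, s2 = s1 ++ u & t1 = u ++ t2.
Proof.
elim: s1 s2 => [|x s1 IH] [|y s2] //=.
- by move=> ->; exists [::].
- by move=> -> _; exists (y :: s2).
- by case=> -> /IH{}IH /IH[u -> ->]; exists u.
Qed.

Lemma size_power (Y : seq nat) k : size (power Y k) = k * size Y.
Proof. by rewrite /power size_flatten /shape map_nseq sumn_nseq mulnC. Qed.

Lemma powerS (Y : seq nat) k : power Y k.+1 = Y ++ power Y k.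
Proof. by []. Qed.

Lemma powerD (Y : seq nat) a b : power Y (a + b) = power Y a ++ power Y b.
Proof. by elim: a => // a IH; rewrite addSn !powerS IH catA. Qed.

Lemma powerSr (Y : seq nat) k : power Y k.+1 = power Y k ++ Y.
Proof. by rewrite -addn1 powerD [power Y 1]cats0. Qed.

Lemma power_rotate (P Q : seq nat) k :
  P ++ power (Q ++ P) k = power (P ++ Q) k ++ P.
Proof.
elim: k => [|k IH]; first by rewrite cats0.
by rewrite !powerS -!catA -IH.
Qed.

(** A cut at the end of a copy is recorded as [Y1 = [::]], never as [Y2 = [::]], so [Y2] always
    starts with the letter after the cut. *)
Lemma power_split (Y Z V : seq nat) k : power Y k = Z ++ V -> V <> [::] ->
  exists a b Y1 Y2, [/\ Y = Y1 ++ Y2, Y2 <> [::], Z = power Y a ++ Y1,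
    V = Y2 ++ power Y b & k = (a + b).+1].
Proof.
elim: k Z => [|k IH] Z; first by case: Z => //; case: V.
rewrite powerS => E V0; have [ltZY|leYZ] := ltnP (size Z) (size Y).
  have [Y2 EY EV] := cat_eq_cat (esym E) (ltnW ltZY).
  exists 0, k, Z, Y2; split=> // Y20.
  by move: ltZY; rewrite EY Y20 cats0 ltnn.
have [Z' EZ E'] := cat_eq_cat E leYZ.
have [a [b [Y1 [Y2 [EY Y20 EZ' EV Ek]]]]] := IH _ E' V0.
exists a.+1, b, Y1, Y2; split=> //; last by rewrite Ek.
by rewrite EZ EZ' powerS catA.
Qed.

Lemma curl_cat (P V : seq nat) : V <> [::] -> curl V <= curl (P ++ V).
Proof.
move=> V0; have [_ [X [Y [Y0 EV]]] _] := curl_spec V0.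
have PV0 : P ++ V <> [::] by case: P => //; case: V V0 {EV}.
have [_ _] := curl_spec PV0; apply; exists (P ++ X), Y.
by rewrite {1}EV catA.
Qed.

Lemma curl_power (Y : seq nat) k : Y <> [::] -> 0 < k -> k <= curl (power Y k).
Proof.
move=> Y0; case: k => // k _.
have U0 : power Y k.+1 <> [::] by rewrite powerS; case: Y Y0.
by have [_ _] := curl_spec U0; apply; exists [::], Y.
Qed.

(** Repetitions with at most [m] copies are absorbed by the maximum. *)
Lemma curlm_le (m : nat) (U : seq nat) (c : nat) : U <> [::] -> m <= c ->
  (forall X Y k, Y <> [::] -> m < k -> U = X ++ power Y k -> k <= c) ->
  curlm m U <= c.
Proof.
move=> U0 mc H; rewrite /curlm geq_max mc /=.
have [_ [X [Y [Y0 EU]]] _] := curl_spec U0.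
have [/leq_trans->//|mk] := leqP (curl U) m.
exact: H Y0 mk EU.
Qed.

(** * Runs of letters other than [m], and the invariant of finite blocks *)

Definition tail_run (m : nat) (s : seq nat) := find (pred1 m) (rev s).

Lemma tail_run_cat_in m s t : m \in t -> tail_run m (s ++ t) = tail_run m t.
Proof. by move=> mt; rewrite /tail_run rev_cat find_cat has_pred1 mem_rev mt. Qed.

(** This includes the case where [m] is absent from [s]: [find] then returns the full length. *)
Lemma tail_run_cat_notin m s t :
  m \notin t -> tail_run m (s ++ t) = size t + tail_run m s.
Proof.
by move=> mt; rewrite /tail_run rev_cat find_cat has_pred1 mem_rev (negbTE mt) size_rev.
Qed.

Lemma tail_run_cat_le m s t : tail_run m (s ++ t) <= size t + tail_run m s.
Proof.
have [mt|mt] := boolP (m \in t); last by rewrite tail_run_cat_notin.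
rewrite tail_run_cat_in // -(size_rev t).
exact: leq_trans (find_size _ _) (leq_addr _ _).
Qed.

Definition run_strict (m : nat) (s : seq nat) := forall P Q,
  s = P ++ Q -> P <> [::] -> Q <> [::] -> tail_run m P < tail_run m s.

Definition self_generated (m : nat) (s : seq nat) := forall P x Q,
  s = P ++ x :: Q -> P <> [::] -> x = curlm m P.

(* T is arbitrary so that the property passes from s to s ++ s ++ S. *)
Definition return_free (m : nat) (s : seq nat) := forall T U Y V V',
  m \notin T -> ~ ends_with_power (s ++ T) 2 -> s = V ++ V' ->
  V <> [::] -> Y <> [::] -> m \notin Y -> s ++ T <> U ++ Y ++ V ++ Y.

Record good_block (m : nat) (s : seq nat) : Prop := GoodBlock {
  good_head : exists t, s = m :: t;
  good_self : self_generated m s;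
  good_run : run_strict m s;
  good_curl : curl s <= m;
  good_return : m = 1 -> return_free m s }.

Lemma head_in (m : nat) t V Q : m :: t = V ++ Q -> V <> [::] -> m \in V.
Proof. by case: V => // x V [<- _] _; rewrite mem_head. Qed.

(** * Curling numbers inside powers of a good block *)

Section Repetition.

Variables (m : nat) (s : seq nat).
Hypotheses (m_gt0 : 0 < m) (good_s : good_block m s).

Let s0 : s <> [::]. Proof. by case: (good_head good_s) => t ->. Qed.

Let prefix_in V Q : s = V ++ Q -> V <> [::] -> m \in V.
Proof. by case: (good_head good_s) => t ->; apply: head_in. Qed.

Let s_in : m \in s. Proof. by apply: (@prefix_in s [::]) => //; rewrite cats0. Qed.

Lemma tail_run_power j : 0 < j -> tail_run m (power s j) = tail_run m s.
Proof. by case: j => // j _; rewrite powerSr tail_run_cat_in. Qed.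

Lemma tail_run_suffix_power j X Z : power s j = X ++ Z -> m \in Z ->
  tail_run m Z = tail_run m s.
Proof.
case: j => [|j] E mZ; first by case: X E => //; case: Z mZ.
by rewrite -(tail_run_cat_in X mZ) -E tail_run_power.
Qed.

Lemma tail_run_proper P Q : s = P ++ Q -> P <> [::] -> Q <> [::] ->
  tail_run m P <> tail_run m s.
Proof. by move=> E P0 Q0 EP; have := good_run good_s E P0 Q0; rewrite EP ltnn. Qed.

(** Peel full copies of [s] off [P]: a nonempty remainder shorter than [s] would have the run of
    [s], against [run_strict]. *)
Lemma boundary_dvdn j P Q : power s j = P ++ Q ->
  tail_run m P = tail_run m s -> size s %| size P.
Proof.
elim: j P => [|j IH] P; first by case: P => // _; rewrite dvdn0.
rewrite powerS => E EP; have [P0|/eqP P0] := eqVneq P [::].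
  by rewrite P0 dvdn0.
have [ltPs|lesP] := ltnP (size P) (size s).
  have [u Es _] := cat_eq_cat (esym E) (ltnW ltPs).
  case: (tail_run_proper Es P0) => // u0.
  by move: ltPs; rewrite Es u0 cats0 ltnn.
have [P2 EPs E2] := cat_eq_cat E lesP.
rewrite EPs size_cat dvdn_addr //; have [->|/eqP P20] := eqVneq P2 [::] => //.
apply: (IH _ E2); rewrite -EP EPs tail_run_cat_in //.
case: j {IH E} E2 => [|j]; first by case: P2 P20 {EPs}.
by case: (good_head good_s) => t -> /head_in; apply.
Qed.

Lemma curlm_power j : 0 < j <= m -> curlm m (power s j) = m.
Proof.
case/andP=> j0 jm; apply/eqP; rewrite eqn_leq leq_maxl andbT.
have W0 : power s j <> [::] by case: j j0 {jm} => // j _; case: s s0.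
apply: curlm_le => // X Y k Y0 mk E.
case: k mk E => [//|[|k]] mk; first by move: mk; rewrite ltnS leqNgt m_gt0.
rewrite powerSr powerSr => E.
have [mY|mY] := boolP (m \in Y).
  (* The last two copies of [Y] both end at boundaries, so [Y] is at least as long as [s], and more
     than [m] copies of it do not fit into [power s j]. *)
  have dvdY : size s %| size Y.
    have d1 : size s %| size (X ++ power Y k ++ Y).
      apply: (@boundary_dvdn j _ Y); first by rewrite E -!catA.
      rewrite !tail_run_cat_in ?mem_cat ?mY ?orbT //.
      by apply: (@tail_run_suffix_power j (X ++ power Y k ++ Y)); rewrite -?catA // E -!catA.
    have: size s %| size (power s j) by rewrite size_power dvdn_mull.
    by rewrite E !catA size_cat -catA (dvdn_addr _ d1).
  have leY := dvdn_leq (_ : 0 < size Y) dvdY.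
  have Es : j * size s = size X + k.+2 * size Y.
    by rewrite -(size_power s j) -(size_power Y k.+2) -size_cat !powerSr E.
  have Yp : 0 < size Y by case: (Y) Y0.
  have sp : 0 < size s by case: (s) s0.
  rewrite leqNgt; apply/negP=> mk2.
  have : k.+2 * size s <= j * size s.
    rewrite Es; apply: leq_trans (leq_addl _ _).
    by rewrite leq_mul2l leY ?orbT.
  rewrite leq_mul2r eqn0Ngt sp /= => kj.
  by have := leq_trans kj jm; rewrite leqNgt mk2.
(* A power free of m is already a suffix of s. *)
rewrite -!powerSr in E.
have mYk : m \notin power Y k.+2.
  by elim: (k.+2) => // i IH; rewrite powerS mem_cat negb_or mY.
have ltY : size (power Y k.+2) <= size s.
  rewrite leqNgt; apply/negP=> lts.
  case: j j0 jm W0 E => // j _ _ _; rewrite powerSr => E.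
  have leX : size X <= size (power s j).
    have := congr1 size E; rewrite (size_cat X) (size_cat (power s j)) => Es.
    by rewrite -(leq_add2r (size (power Y k.+2))) -Es leq_add2l ltnW.
  have [u _ EY] := cat_eq_cat (esym E) leX.
  by move: mYk; rewrite EY mem_cat s_in orbT.
case: j j0 jm W0 E => // j _ _ _; rewrite powerSr => E.
have leX : size (power s j) <= size X.
  have := congr1 size E; rewrite (size_cat X) (size_cat (power s j)) => Es.
  by rewrite -(leq_add2r (size s)) Es leq_add2l.
have [u _ Es] := cat_eq_cat E leX.
have [_ _ H] := curl_spec s0.
have := leq_trans (H k.+2 (ex_intro _ u (ex_intro _ Y (conj Y0 Es)))) (good_curl good_s).
by rewrite leqNgt mk.
Qed.

Lemma curlm_power_cat j V V' : j <= m -> s = V ++ V' -> V <> [::] ->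
  V' <> [::] -> curlm m (power s j ++ V) = curlm m V.
Proof.
move=> jm Es V0 V'0; apply/eqP; rewrite eqn_leq; apply/andP; split; last first.
  by rewrite /curlm geq_max leq_maxl leq_max curl_cat ?orbT.
have W0 : power s j ++ V <> [::] by case: (power s j) => //; case: V V0 {Es}.
have mV : m \in V := prefix_in Es V0.
have [_ _ maxV] := curl_spec V0.
apply: curlm_le; rewrite ?leq_maxl // => X Y k Y0 mk E.
rewrite /curlm leq_max; apply/orP; right.
have [lejX|ltXj] := leqP (size (power s j)) (size X).
  have [u _ EV] := cat_eq_cat E lejX.
  by apply: maxV; exists u, Y.
have [Z EZ EYk] := cat_eq_cat (esym E) (ltnW ltXj).
have Z0 : Z <> [::] by move=> Z0; move: ltXj; rewrite EZ Z0 cats0 ltnn.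
(* [Z] is the part of the repetition inside [power s j]; [a] and [b] count the full copies of [Y] in
   [Z] and in [V]. *)
have [a [b [Y1 [Y2 [EY Y20 EZa EV Ek]]]]] := power_split EYk V0.
have proper P Q : V = P ++ Q -> m \in P -> tail_run m P <> tail_run m s.
  move=> EP mP; apply: (@tail_run_proper P (Q ++ V')).
  - by rewrite Es EP catA.
  - by case: (P) mP.
  - by case: (Q) => //; case: (V') V'0.
have mY : m \in Y2 ++ Y1.
  rewrite mem_cat orbC -mem_cat -EY; move: mV; rewrite EV mem_cat.
  case/orP=> [m2|]; first by rewrite EY mem_cat m2 orbT.
  by elim: (b) => // i IH; rewrite powerS mem_cat => /orP[//|/IH].
case: a => [|a] in EZa Ek *.
  rewrite /= in EZa; rewrite -{Y1}EZa in EY mY.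
  have b0 : m <= b by rewrite -ltnS -(add0n b) -Ek.
  have b1 : 0 < b := leq_trans m_gt0 b0.
  have EV2 : V = power (Y2 ++ Z) b ++ Y2 by rewrite EV EY power_rotate.
  have mZ : m \notin Z.
    (* Otherwise the prefix [Y2 ++ Z] of [V] has the run of [s], because [Z] is a suffix of
       [power s j]. *)
    apply/negP=> mZ; apply: (proper (Y2 ++ Z) (power (Y2 ++ Z) b.-1 ++ Y2)).
    - by rewrite EV2 -{1}(prednK b1) powerS -!catA.
    - by rewrite mem_cat mZ orbT.
    - by rewrite tail_run_cat_in //; have := tail_run_suffix_power EZ mZ.
  case EY2: Y2 Y20 => [//|x Y3] _.
  have xm : x = m.
    by case: (good_head good_s) => t; rewrite Es EV EY2 => -[].
  (* A repetition with more than m copies inside V would be followed by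
     a letter larger than m, yet here it is followed by m. *)
  have bm : b = m.
    apply/eqP; rewrite eqn_leq b0 andbT leqNgt; apply/negP=> mb.
    have [c Eb] : exists c, b = m.+1 + c by exists (b - m.+1); rewrite subnKC.
    have Q0 : Y2 ++ Z <> [::] by rewrite EY2.
    have [Q EQ] : exists Q, power (Y2 ++ Z) c ++ Y2 = m :: Q.
      by case: (c) => [|i]; rewrite ?powerS EY2 xm; eexists; rewrite /= -?catA.
    have EsQ : s = power (Y2 ++ Z) m.+1 ++ m :: (Q ++ V').
      by rewrite {1}Es EV2 Eb powerD -!catA (catA (power _ c)) EQ.
    have P0 : power (Y2 ++ Z) m.+1 <> [::] by rewrite powerS EY2.
    have := leq_maxr m (curl (power (Y2 ++ Z) m.+1)).
    rewrite -/(curlm _ _) -(good_self good_s EsQ P0) leqNgt => /negP; apply.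
    exact: curl_power.
  case EZ0: Z Z0 => [//|z Z1] _.
  have zm : z != m by apply: contra mZ => /eqP <-; rewrite EZ0 mem_head.
  have Es2 : s = Y2 ++ z :: (Z1 ++ power (Y2 ++ Z) b.-1 ++ Y2 ++ V').
    by rewrite {1}Es EV2 -{1}(prednK b1) powerS EZ0 -!catA.
  have Y20 : Y2 <> [::] by rewrite EY2.
  have Ez := good_self good_s Es2 Y20.
  (* The letter [z] follows [Y2] in [s] and differs from [m], so it is the curling number of
     [Y2]. *)
  have mc : m < curl Y2.
    rewrite ltnNge; apply/negP => /maxn_idPl H.
    by move: zm; rewrite Ez /curlm H eqxx.
  rewrite Ek add0n bm (leq_trans mc) // EV2.
  exact: curl_cat.
have EZr : Z = Y1 ++ power (Y2 ++ Y1) a.+1.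
  by rewrite EZa EY power_rotate.
(* A full copy of [Y] in [V] would make [Y2 ++ Y1] both a prefix of [V] and a suffix of
   [power s j]. *)
case: b => [|b] in EV Ek *; last first.
  case: (proper (Y2 ++ Y1) (Y2 ++ power Y b)) => //.
    by rewrite EV powerS {1}EY -!catA.
  apply: (@tail_run_suffix_power j (X ++ Y1 ++ power (Y2 ++ Y1) a)) => //.
  by rewrite EZ EZr powerSr -!catA.
rewrite [power Y 0]/= cats0 in EV; rewrite -{Y2 Y20}EV in EY mY EZr.
rewrite addn0 in Ek.
have ma : m <= a.+1 by rewrite -ltnS -Ek.
(* A single full copy of [Y] in [Z] forces [m = 1] and [j = 1]; then [s] ends in [Y1 ++ V ++ Y1],
   which [return_free] excludes. *)
exfalso; case: a => [|a] in ma Ek EZa EZr *.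
  have m1 : m = 1 by apply/eqP; rewrite eqn_leq ma.
  have j1 : j = 1.
    apply/eqP; rewrite eqn_leq -{1}m1 jm lt0n; apply/eqP=> j0.
    by move: EZ; rewrite j0; case: (X) => //; case: (Z) Z0.
  have Es3 : s = X ++ Y1 ++ V ++ Y1.
    by move: EZ; rewrite j1 /power /= cats0 EZr /power /= cats0.
  have Y10 : Y1 <> [::].
    move=> Y10; rewrite Y10 !cats0 /= in Es3.
    apply: (proper V [::]); rewrite ?cats0 //.
    by rewrite Es3 tail_run_cat_in.
  have mY1 : m \notin Y1.
    apply/negP => mY1; apply: (@tail_run_proper (X ++ Y1) (V ++ Y1)).
    - by rewrite {1}Es3 -!catA.
    - by case: (X) => //; case: (Y1) Y10.
    - by case: (V) V0.
    - by rewrite Es3 !tail_run_cat_in ?mem_cat ?mY1 ?orbT.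
  apply: (good_return good_s m1 (T := [::]) (U := X) _ _ Es V0 Y10 mY1) => //.
    rewrite cats0 => H; have [_ _ /(_ _ H)] := curl_spec s0.
    by move=> c2; have := leq_trans c2 (good_curl good_s); rewrite m1.
  by rewrite cats0.
(* Now [Z] ends in two copies of [V ++ Y1], both ending at boundaries, so each is at least as long
   as [s]. As [j <= m <= a.+2], there is no room left for the nonempty [Y1] in front. *)
have dvdl : size s %| size (V ++ Y1).
  have Ep : power s j = ((X ++ Y1) ++ power (V ++ Y1) a.+1) ++ (V ++ Y1).
    by rewrite EZ EZr powerSr !catA.
  have tV : tail_run m (V ++ Y1) = tail_run m s by apply: tail_run_suffix_power Ep mY.
  have d1 : size s %| size ((X ++ Y1) ++ power (V ++ Y1) a.+1).
    apply: boundary_dvdn Ep _.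
    by rewrite powerSr catA tail_run_cat_in.
  have: size s %| size (power s j) by rewrite size_power dvdn_mull.
  by rewrite Ep size_cat (dvdn_addr _ d1).
have Vp : 0 < size V by case: (V) V0.
have leY : size s <= size (V ++ Y1).
  by apply: dvdn_leq; rewrite // size_cat addn_gt0 Vp.
have ltVs : size V < size s.
  by rewrite Es size_cat -addn1 leq_add2l; case: (V') V'0.
have Y1p : 0 < size Y1.
  rewrite lt0n; apply/eqP => Y10; move: leY.
  by rewrite size_cat Y10 addn0 leqNgt ltVs.
have Esz : j * size s = size X + (size Y1 + a.+2 * size (V ++ Y1)).
  by rewrite -(size_power s j) EZ EZr (size_cat X) (size_cat Y1) size_power.
have : j * size s < j * size s.
  rewrite {2}Esz addnCA -[X in X < _]add0n -addSn.
  apply: leq_add => //.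
  rewrite (leq_trans _ (leq_addl _ _)) //.
  by apply: leq_mul => //; apply: leq_trans jm ma.
by rewrite ltnn.
Qed.

(** At most [m] full copies precede any letter, so the two lemmas above apply: a letter at a
    boundary is the head [m], the others are inherited from [s]. *)
Lemma self_generated_power : self_generated m (power s m.+1).
Proof.
move=> P x Q E P0.
have [//|a [b [Y1 [Y2 [EY Y20 EP EV Ek]]]]] := power_split E.
have am : a <= m by case: Ek => ->; rewrite leq_addr.
case EY2: Y2 Y20 EV => [//|y Y3] _ [Exy _].
have [Y10|/eqP Y10] := eqVneq Y1 [::].
  rewrite Y10 cats0 in EP; rewrite EP curlm_power.
    by case: (good_head good_s) => t; rewrite EY Y10 EY2 Exy => -[].
  by rewrite am andbT; case: a EP {am Ek} => [EP|//]; case: P0.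
rewrite EP (@curlm_power_cat _ _ Y2) // ?EY2 //.
by apply: (good_self good_s (Q := Y3)) => //; rewrite EY EY2 Exy.
Qed.

End Repetition.

(** * Passing the invariant from a block to the next one *)

(** The final run is the run of [s] lengthened by all of [S]; a prefix ending in the copies gains
    nothing from [S], and one reaching into [S] misses some of its letters. *)
Lemma run_strict_glue m s S k : (exists t, s = m :: t) -> run_strict m s ->
  m \notin S -> S <> [::] -> run_strict m (power s k.+1 ++ S).
Proof.
move=> hs rs mS S0 P Q E P0 Q0.
have s_in : m \in s by case: hs => t ->; rewrite mem_head.
have Er : tail_run m (power s k.+1 ++ S) = size S + tail_run m s.
  by rewrite tail_run_cat_notin // powerSr tail_run_cat_in.
have Sp : 0 < size S by case: (S) S0.
rewrite Er; have [lesP|ltPs] := leqP (size (power s k.+1)) (size P).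
  have [u EP ES] := cat_eq_cat E lesP.
  rewrite EP (leq_ltn_trans (tail_run_cat_le _ _ _)) //.
  rewrite powerSr tail_run_cat_in // ltn_add2r ES size_cat -addn1 leq_add2l.
  by case: (Q) Q0.
have [u Eu _] := cat_eq_cat (esym E) (ltnW ltPs).
have u0 : u <> [::] by move=> u0; move: ltPs; rewrite Eu u0 cats0 ltnn.
have [a [b [Y1 [Y2 [EY Y20 EP _ _]]]]] := power_split Eu u0.
have [Y10|/eqP Y10] := eqVneq Y1 [::].
  move: EP; rewrite Y10 cats0; case: a => [|a] EP; first by case: P0.
  by rewrite EP powerSr tail_run_cat_in // -[X in X < _]add0n ltn_add2r.
have mY1 : m \in Y1 by case: hs => t; rewrite EY => /esym/head_in; apply.
rewrite EP tail_run_cat_in //.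
exact: leq_trans (rs _ _ EY Y10 Y20) (leq_addl _ _).
Qed.

(** For [m = 1] the next block has the form [s ++ s ++ S]. The cases follow where the first [Y]
    starts relative to the end of the first copy of [s]. *)
Lemma return_free_glue m s S : (exists t, s = m :: t) -> run_strict m s ->
  return_free m s -> m \notin S -> S <> [::] -> return_free m (s ++ s ++ S).
Proof.
move=> hs rs IH mS S0 T U Y V V' mT nsq EV V0 Y0 mY E.
have s_in : m \in s by case: hs => t ->; rewrite mem_head.
have Yp : 0 < size Y by case: (Y) Y0.
have mST : m \notin S ++ T by rewrite mem_cat negb_or mS.
have mV : m \in V by case: hs EV => t -> /head_in; apply.
have {}E : s ++ (s ++ S ++ T) = U ++ Y ++ V ++ Y by rewrite -E -!catA.
have nsq2 : ~ ends_with_power (s ++ S ++ T) 2.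
  move=> [X [D [D0 ED]]]; apply: nsq; exists (s ++ X), D; split=> //.
  by rewrite -!catA ED.
have [lesU|ltUs] := leqP (size s) (size U).
  have [u _ E2] := cat_eq_cat E lesU.
  have [lesV|ltVs] := leqP (size s) (size V); last first.
    have [w Es _] := cat_eq_cat (esym EV) (ltnW ltVs).
    (* Here [S ++ T] takes the role of [T]. *)
    exact: IH mST nsq2 Es V0 Y0 mY E2.
  have [w EVs _] := cat_eq_cat EV lesV.
  (* The final run contains [S ++ T] and the run of [s]; a [V] starting with [s] would confine it to
     [w ++ Y] and that run, which is too short. *)
  have Et : tail_run m (s ++ S ++ T) = tail_run m (s ++ w ++ Y).
    by rewrite E2 EVs -!catA (catA u) tail_run_cat_in // mem_cat s_in.
  have := tail_run_cat_le m s (w ++ Y); rewrite -Et tail_run_cat_notin //.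
  rewrite leq_add2r leqNgt => /negP; apply.
  have := congr1 size E2; rewrite EVs !size_cat => Esz.
  rewrite -(ltn_add2l (size s)) Esz -!addnA ltnNge; apply/negP.
  move=> /(leq_trans (leq_addl (size u) _)).
  by rewrite addnCA leq_add2l leqNgt -[X in X < _]add0n ltn_add2r Yp.
have [D Es ED] := cat_eq_cat (esym E) (ltnW ltUs).
have D0 : D <> [::] by move=> D0; move: ltUs; rewrite Es D0 cats0 ltnn.
have [ltDY|leYD] := ltnP (size D) (size Y).
  have [w EY Ew] := cat_eq_cat (esym ED) (ltnW ltDY).
  have w0 : w <> [::] by move=> w0; move: ltDY; rewrite EY w0 cats0 ltnn.
  have mw : m \in w by case: hs Ew => t -> /head_in; apply.
  by move: mY; rewrite EY mem_cat mw orbT.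
have [X EX EVY] := cat_eq_cat ED leYD.
have [X0|/eqP X0] := eqVneq X [::].
  rewrite X0 /= in EVY; rewrite X0 cats0 in EX.
  have [ltVs|leVs] := ltnP (size s) (size V).
    have [w EVs Ew] := cat_eq_cat (esym EVY) (ltnW ltVs).
    have w0 : w <> [::] by move=> w0; move: ltVs; rewrite EVs w0 cats0 ltnn.
    have mw : m \in w.
      move: EV; rewrite EVs -catA => /eqP; rewrite eqseq_cat // eqxx /= => /eqP.
      by case: hs => t -> /head_in; apply.
    by move: mST; rewrite Ew mem_cat mw.
  have [w Ew1 Ew2] := cat_eq_cat EVY leVs.
  (* Since [Y = w ++ S ++ T] is a suffix of [s], the string [s ++ S ++ T] ends in the square of
     [S ++ T]. *)
  apply: nsq2; exists (U ++ w), (S ++ T); split; first by case: (S) S0.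
  by rewrite {1}Es EX Ew2 /power /= cats0 -!catA.
have mX : m \in X.
  have [leVX|/ltnW leXV] := leqP (size V) (size X).
    have [w -> _] := cat_eq_cat EVY leVX.
    by rewrite mem_cat mV.
  have [w EVX _] := cat_eq_cat (esym EVY) leXV.
  by case: hs EV => t ->; rewrite EVX -catA => /head_in; apply.
have ltXV : size X < size V.
  rewrite ltnNge; apply/negP => leVX.
  have [w _ EYw] := cat_eq_cat EVY leVX.
  by move: mY; rewrite EYw !mem_cat s_in orbT.
have [w EVX _] := cat_eq_cat (esym EVY) (ltnW ltXV).
(* [X] contains [m] and turns out to be both a suffix and a proper prefix of [s], against
   [run_strict]. *)
have EUX : s = (U ++ Y) ++ X by rewrite Es EX catA.
have ltXs : size X < size s.
  by rewrite EUX !size_cat -[X in X < _]add0n ltn_add2r addn_gt0 Yp orbT.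
rewrite EVX -catA in EV.
have [z Esz _] := cat_eq_cat (esym EV) (ltnW ltXs).
have z0 : z <> [::] by move=> z0; move: ltXs; rewrite Esz z0 cats0 ltnn.
have := rs _ _ Esz X0 z0.
by rewrite EUX tail_run_cat_in // ltnn.
Qed.

Lemma good_block_singleton m : 0 < m -> good_block m [:: m].
Proof.
move=> m0; split.
- by exists [::].
- by move=> [|y [|z P]] x Q.
- by move=> [|y [|z P]] [|x Q].
- rewrite (leq_trans _ m0) //; have [//|_ [X [Y [Y0 E]]] _] := @curl_spec [:: m].
  have := congr1 size E; rewrite size_cat size_power /= => ->.
  by rewrite (leq_trans _ (leq_addl _ _)) // leq_pmulr //; case: (Y) Y0.
- move=> _ T U Y V V' mT _ EV V0 Y0 mY E.
  have mV : m \in V by have := head_in EV; apply.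
  case: U E => [|x U].
    by case: Y Y0 mY => // y Y _ mY [Ey _]; rewrite -Ey mem_head in mY.
  by case=> _ ET; move: mT; rewrite ET !mem_cat mV /= !orbT.
Qed.

(** * Self-generated strings, glue and the comparison with [A] *)

Lemma self_generated_rcons m P :
  self_generated m P -> self_generated m (rcons P (curlm m P)).
Proof.
move=> gP P1 x Q; case/lastP: Q => [|Q y].
  by rewrite cats1 => /rcons_inj[-> ->].
by rewrite -rcons_cons -rcons_cat => /rcons_inj[EP _]; apply: gP EP.
Qed.

Lemma self_generated_continuation m P n :
  self_generated m P -> self_generated m (P ++ continuation m P n).
Proof.
move=> gP; elim: n => [|n IH]; first by rewrite cats0.
by rewrite /= -rcons_cat; apply: self_generated_rcons.
Qed.

Lemma continuationE m P n : continuation m P n = mkseq (next_term m P) n.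
Proof. by elim: n => //= n IH; rewrite mkseqS {1}IH. Qed.

(** The initial [m] and self-generation force the letters one by one, by the recursion of [A]. *)
Lemma self_generated_nth m t i : self_generated m (m :: t) ->
  i <= size t -> nth 0 (m :: t) i = A m i.
Proof.
move=> gt; case: i => // i it.
suff E j : j <= size t -> [:: m] ++ continuation m [:: m] j = take j.+1 (m :: t).
  rewrite /= /next_term E ?(ltnW it) //.
  apply: (gt _ _ (drop i.+1 t)) => //.
  by rewrite /= -drop_nth // cat_take_drop.
elim: j => [|j IH] jt; first by rewrite /= take0.
rewrite [continuation _ _ _]/= -rcons_cat IH ?(ltnW jt) //.
rewrite [take j.+2 _](take_nth 0) //; congr rcons; apply/esym.
apply: (gt _ _ (drop j.+1 t)) => //.
by rewrite (IH (ltnW jt) : m :: _ = _) /= -drop_nth // cat_take_drop.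
Qed.

(** Index 0 never satisfies [glue_stops]; there the bound comes from the [m.+1] copies of [s]. *)
Lemma next_term_ge m s i : s <> [::] ->
  (forall j, j <= i -> ~~ glue_stops m (power s m.+1) j) ->
  m < next_term m (power s m.+1) i.
Proof.
move=> s0; case: i => [|i] H.
  by rewrite /next_term cats0 leq_max curl_power ?orbT.
by have := H i.+1 (leqnn _); rewrite /glue_stops /= -leqNgt.
Qed.

Lemma good_block_glue m s i : 0 < m -> good_block m s ->
  glue_stops m (power s m.+1) i ->
  (forall j, glue_stops m (power s m.+1) j -> i <= j) ->
  good_block m (power s m.+1 ++ continuation m (power s m.+1) i).
Proof.
move=> m0 gs /andP[i0 stop] mini; set S := continuation _ _ _.
have hs := good_head gs.
have s0 : s <> [::] by case: hs => t ->.
have mS : m \notin S.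
  rewrite /S continuationE; apply/mapP => -[j]; rewrite mem_iota /= add0n => ji Em.
  have := @next_term_ge m s j s0; rewrite -Em ltnn => H.
  suff: false by [].
  by apply: H => l lj; apply/negP => /mini; rewrite leqNgt (leq_ltn_trans lj).
have S0 : S <> [::] by move/(congr1 size); rewrite /S continuationE size_mkseq; case: (i) i0.
split.
- by case: hs => t ->; eexists; rewrite powerS.
- exact: self_generated_continuation (self_generated_power m0 gs).
- exact: run_strict_glue (good_run gs) mS S0.
(* The term that stops the glue is at least the curling number of the new block. *)
- by move: stop; rewrite ltnS => /(leq_trans (leq_maxr _ _)).
- move=> m1; rewrite {1 2}m1 /power /= cats0 -catA -m1.
  exact: return_free_glue (good_run gs) (good_return gs m1) mS S0.
Qed.

Lemma block_good m n : 0 < m ->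
  (exists2 s, block m n = Fin s & good_block m s) \/ block m n = Inf (A m).
Proof.
move=> m0; elim: n => [|n [[s E gs]|E]].
- by left; exists [:: m] => //; apply: good_block_singleton.
- rewrite blockS E /glue E /= /glue_after.
  case: pselect => [stops|nstops].
    case: ex_minnP => i stop mini; left; eexists; first by [].
    exact: good_block_glue.
  right; congr Inf; apply/funext => i.
  (* A finite stage of the glue reaching position [i]; the truncated subtraction gives 0 when [i]
     lies inside [P]. *)
  set P := power s m.+1; set j := i.+1 - size P.
  have gP := @self_generated_continuation m P j (self_generated_power m0 gs).
  have [t Et] : exists t, P ++ continuation m P j = m :: t.
    case: (good_head gs) => t Es; exists (t ++ power s m ++ continuation m P j).
    by rewrite {1}/P powerS {1}Es -catA.
  rewrite -/P Et in gP.
  have it : i <= size t.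
    rewrite -ltnS -/(size (m :: t)) -Et size_cat continuationE size_mkseq.
    by rewrite -leq_subLR.
  rewrite -(self_generated_nth gP it) -Et nth_cat; case: ifP => // /negbT.
  by rewrite -leqNgt => Pi; rewrite continuationE nth_mkseq // /j subSn.
- by right; rewrite blockS E.
Qed.

Theorem theorem2 (m : nat) (hm : 1 <= m) : Inf (A m) = B m.
Proof.
(* From [n = i] on, [letter_block] guarantees a letter at position [i]. *)
apply: (converges_unique _ (block_converges hm)) => i; exists i => n ni.
case: (block_good n hm) => [[s E gs]|->//].
have := letter_block hm ni; rewrite E /= => si.
have [t Es] := good_head gs; have := good_self gs.
case E2: (onth s i) si => [x|//] _; have [ltis <-] := onth_some E2.
by rewrite Es in ltis * => /self_generated_nth->.
Qed.
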